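(* Let $K:(0,\infty)^2\to[0,\infty)$ be measurable and symmetric. For $r>1$ and $a>0$ set $H(a)=a\,\inf\{K(x,y): x,y\in[a,ra]\}$. Assume that there exist $x_0>0$ and $r>1$ such that $$\kappa:=\int_{x_0}^\infty [H(a)]^{-1/2}\,\mathrm{d}a<\infty .$$ Then for any weak solution $(f_t)_{t\ge 0}$ to the Smoluchowski coagulation equation with kernel $K$ such that $M_1(f_0)<\infty$ and $f_0((x_0,\infty))>0$, we have $$T_{gel}:=\inf\{t\ge 0: M_1(f_t)<M_1(f_0)\}\le 2\kappa^2\Big(\frac{r}{r-1}\Big)^2\frac{M_1(f_0)}{\big[\int_{x_0}^\infty (x-x_0)\,f_0(\mathrm{d}x)\big]^2}.$$
   Context: For a nonnegative measure $f$ on $(0,\infty)$ and $k\in\mathbb{R}$, $M_k(f)=\int_0^\infty x^k f(\mathrm{d}x)$. Weak solution: let $K:(0,\infty)^2\to[0,\infty)$ be measurable and symmetric ($K(x,y)=K(y,x)$). A measurable family $(f_t)_{t\ge0}$ of nonnegative measures on $(0,\infty)$ is a weak solution to the Smoluchowski coagulation equation with kernel $K$ if for all $t\ge0$, $$\int_0^t\int_0^\infty\int_0^\infty K(x,y)\,f_s(\mathrm{d}y)f_s(\mathrm{d}x)\,\mathrm{d}s<\infty,$$ and for all bounded measurable $\psi:(0,\infty)\to[0,\infty)$ and all $t\ge0$, $$\int_0^\infty\psi(x)f_t(\mathrm{d}x)=\int_0^\infty\psi(x)f_0(\mathrm{d}x)+\frac12\int_0^t\int_0^\infty\int_0^\infty\Delta_\psi(x,y)K(x,y)\,f_s(\mathrm{d}y)f_s(\mathrm{d}x)\,\mathrm{d}s,$$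 where $\Delta_\psi(x,y)=\psi(x+y)-\psi(x)-\psi(y)$. The first two terms of this identity take values in $[0,\infty)\cup\{+\infty\}$, and the last one is finite. Conventions: $0^{-1/2}=+\infty$ and $\inf\emptyset=+\infty$. *)

(* Defs.v *)
From HB Require Import structures.
From mathcomp Require Import all_boot all_order all_algebra.
From mathcomp Require Import all_classical all_reals all_analysis.
From mathcomp Require Import measurable_realfun.
Set Implicit Arguments.
Unset Strict Implicit.
Unset Printing Implicit Defensive.
Import Order.TTheory GRing.Theory Num.Theory.
Import numFieldNormedType.Exports.
Local Open Scope classical_set_scope.
Local Open Scope ring_scope.
Local Open Scope ereal_scope.

(* A measure on (0, +oo) is represented by a Borel measure on R, and a function
   on (0, +oo) (or on its square) by a total function on R: every hypothesis
   and every integral below only looks at (0, +oo), so that masses or values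
   elsewhere are irrelevant.  Likewise, families indexed by t >= 0 are indexed
   by R and only looked at for t >= 0. *)

Definition coagulation_kernel (R : realType) (K : R -> R -> R) : Prop :=
  [/\ measurable_fun
        ((`]0%R, +oo[ : set (measurableTypeR R)) `*`
         (`]0%R, +oo[ : set (measurableTypeR R)))
        (fun z : measurableTypeR R * measurableTypeR R => K z.1 z.2),
      (forall x y : R, (0 < x)%R -> (0 < y)%R -> (0 <= K x y)%R) &
      (forall x y : R, (0 < x)%R -> (0 < y)%R -> K x y = K y x)].

Definition moment (R : realType) (k : R)
    (f : {measure set (measurableTypeR R) -> \bar R}) : \bar R :=
  \int[f]_(x in `]0%R, +oo[) (x `^ k)%:E.

Definition Delta (R : realType) (psi : R -> R) (x y : R) : R :=
  (psi (x + y) - psi x - psi y)%R.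

Definition bounded_test_function (R : realType) (psi : R -> R) : Prop :=
  [/\ measurable_fun (`]0%R, +oo[ : set (measurableTypeR R))
        (psi : measurableTypeR R -> R),
      (forall x : R, (0 < x)%R -> (0 <= psi x)%R) &
      (exists C : R, forall x : R, (0 < x)%R -> (psi x <= C)%R)].

(* The last term of the weak identity is finite as a consequence of the
   integrability condition, since |Delta psi| <= 2 sup psi; the sum is thus
   never of the form +oo + -oo. *)
Definition weak_solution (R : realType) (K : R -> R -> R)
    (f : R -> {measure set (measurableTypeR R) -> \bar R}) : Prop :=
  [/\ (forall A : set (measurableTypeR R), measurable A ->
         A `<=` `]0%R, +oo[ ->
         measurable_fun (`[0%R, +oo[ : set (measurableTypeR R))
           (f ^~ A : measurableTypeR R -> \bar R)),
      (forall t : R, (0 <= t)%R ->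
         \int[lebesgue_measure]_(s in `[0%R, t])
           \int[f s]_(x in `]0%R, +oo[) \int[f s]_(y in `]0%R, +oo[)
             (K x y)%:E < +oo) &
      (forall psi : R -> R, bounded_test_function psi ->
       forall t : R, (0 <= t)%R ->
         \int[f t]_(x in `]0%R, +oo[) (psi x)%:E =
         \int[f 0%R]_(x in `]0%R, +oo[) (psi x)%:E +
         (2^-1)%:E *
           \int[lebesgue_measure]_(s in `[0%R, t])
             \int[f s]_(x in `]0%R, +oo[) \int[f s]_(y in `]0%R, +oo[)
               (Delta psi x y * K x y)%:E)].

Definition Hinf (R : realType) (K : R -> R -> R) (r a : R) : R :=
  (a * inf [set K x y | x in `[a, r * a] & y in `[a, r * a]])%R.

(* The inverse is taken in \bar R, where 0^-1 = +oo. *)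
Definition kappa (R : realType) (K : R -> R -> R) (r x0 : R) : \bar R :=
  \int[lebesgue_measure]_(a in `]x0, +oo[) ((Num.sqrt (Hinf K r a))%:E)^-1.

(* ereal_inf set0 = +oo. *)
Definition Tgel (R : realType)
    (f : R -> {measure set (measurableTypeR R) -> \bar R}) : \bar R :=
  ereal_inf [set t%:E | t in
    [set t : R | (0 <= t)%R /\ moment 1 (f t) < moment 1 (f 0%R)]].

(* Main.v *)
Require Import Defs.
From HB Require Import structures.
From mathcomp Require Import all_boot all_order all_algebra.
From mathcomp Require Import all_classical all_reals all_analysis.
From mathcomp Require Import measurable_realfun.
From mathcomp Require Import ring lra.
Import Order.TTheory GRing.Theory Num.Theory.
Import numFieldNormedType.Exports.
Local Open Scope classical_set_scope.
Local Open Scope ring_scope.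
Local Open Scope ereal_scope.

(** The idea is to follow the mass of clusters of size comparable to [a].
    Testing the equation with [x |-> min x a] shows that this truncated moment
    dissipates: two clusters of sizes larger than [a] lose exactly [a] when they
    merge, so the rate of loss is at least [a / 2] times the infimum of [K] over the
    square with side [window r a = ]a, r a[], times [f_s(]a, r a[)^2].  The
    truncated moment starts below [M_1(f_0)] and stays nonnegative, whence
      [(a inf K) int_0^t f_s(]a, r a[)^2 ds <= 2 M_1(f_0)]
    ([window_square_bound]).

    On the other hand, integrating [f_s(]a, r a[)] over [a > x0] and exchanging
    the integrals gives at least [(1 - 1/r) int (x - x0)_+ f_s(dx)]
    ([le_integral_windows]).  As long as no mass is lost, this excess moment is
    at least its initial value: it is the difference between the total mass,
    which is then at least that of [f_0], and the moment truncated at [x0], which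
    never increases ([excess_moment_le]).  So the windows carry a fixed amount
    [c] of mass at each time before gelation, while each of them is small in
    [L^2(0, t)].  A Cauchy-Schwarz inequality with the weight
    [(a inf K)^(1/2)] ([weighted_cauchy_schwarz]) turns this into
    [c^2 t <= 2 M_1(f_0) kappa^2], which is the claimed bound on [t].

    The windows are open, whereas [Hinf] uses closed squares.  Integrated over
    [a], open and closed windows carry the same mass.  The infimum over the open
    square is larger, so that its power [-1/2] still has an integral at most
    [kappa], and it is upper semicontinuous in [a], hence measurable
    ([measurable_Kinf]). *)

(** * Complements on integration *)

(** The integral of a nonnegative function is a supremum over the simple
    functions below it, so it is monotone on arbitrary functions.  It gets
    applied to [Hinf], to [K] and to iterated integrals of [K]. *)
Lemma le_integral_nonmeasurable d (T : measurableType d) (R : realType)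
    (mu : {measure set T -> \bar R}) (D : set T) (f g : T -> \bar R) :
  (forall x, D x -> 0 <= f x) -> (forall x, D x -> f x <= g x) ->
  \int[mu]_(x in D) f x <= \int[mu]_(x in D) g x.
Proof.
move=> f0 fg; have g0 x : D x -> 0 <= g x.
  by move=> Dx; exact: le_trans (f0 _ Dx) (fg _ Dx).
rewrite !ge0_integralE//; apply: ereal_sup_le => _ [h hf <-].
exists h => // x; apply: le_trans (hf x) _; exact: lee_restrict.
Qed.

Lemma le_inve {R : realType} (x y : \bar R) : 0 <= x -> x <= y -> y^-1 <= x^-1.
Proof.
case: x => [x| |]//; case: y => [y| |]//.
- rewrite !lee_fin !inver => x0 xy; have [_|xn0] := eqVneq x 0%R; first by rewrite leey.
  have xp : (0 < x)%R by rewrite lt0r xn0.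
  by rewrite gt_eqF ?(lt_le_trans xp)// lee_fin lef_pV2// posrE (lt_le_trans xp).
- by rewrite lee_fin => x0 _; rewrite invey inve_ge0 lee_fin.
Qed.

Lemma le_sqre {R : realType} (x y : \bar R) : 0 <= x -> x <= y -> x ^+ 2 <= y ^+ 2.
Proof. by move=> x0 xy; rewrite !expe2 lee_pmul. Qed.

Lemma measurable_inve_EFin d (T : measurableType d) (R : realType)
    (D : set T) (f : T -> R) : measurable D -> measurable_fun D f ->
  (forall x, D x -> (0 <= f x)%R) ->
  measurable_fun D (fun x => (f x)%:E^-1).
Proof.
move=> mD mf f0.
apply: (@eq_measurable_fun _ _ _ _ D
  (fun x => if f x == 0%R then +oo else (f x `^ (-1))%:E)).
  move=> x /set_mem Dx; rewrite inver; case: ifPn => // fx0.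
  by rewrite powR_inv1// f0.
apply: measurable_fun_if => //.
- by apply: (measurable_fun_eqr mf); exact: measurable_cst.
- apply/measurable_EFinP; apply: (measurableT_comp (@measurable_powR R (-1))).
  apply: measurable_funS mf => //; exact: subIsetl.
Qed.

Lemma measurable_sqre d (T : measurableType d) (R : realType) (D : set T)
    (f : T -> \bar R) : measurable_fun D f -> measurable_fun D (fun x => f x ^+ 2).
Proof. by move=> mf; under eq_fun do rewrite expe2; exact: emeasurable_funM. Qed.

(** * Infimum of the kernel over open squares *)

Definition window {R : realType} (r a : R) : set R := `]a, (r * a)%R[%classic.

Definition Kinf {R : realType} (K : R -> R -> R) (r a : R) : R :=
  inf [set K x y | x in window r a & y in window r a].

Section kernel_infimum.
Context {R : realType}.
Variables (K : R -> R -> R) (r x0 : R).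
Hypothesis x0_gt0 : (0 < x0)%R.
Hypothesis r_gt1 : (1 < r)%R.
Hypothesis K_ge0 : forall x y : R, (0 < x)%R -> (0 < y)%R -> (0 <= K x y)%R.

Lemma Kinf_lbound a : (0 < a)%R ->
  lbound [set K x y | x in window r a & y in window r a] 0%R.
Proof.
move=> a0 _ [x + [y + <-]]; rewrite /window/= !in_itv/=.
move=> /andP[ax _] /andP[ay _].
by apply: K_ge0; [exact: lt_trans ax|exact: lt_trans ay].
Qed.

Lemma Kinf_nonempty a : (0 < a)%R ->
  [set K x y | x in window r a & y in window r a] !=set0.
Proof.
move=> a0; pose m : R := ((a + r * a) / 2)%R.
have mI : window r a m.
  have ara : (a < r * a)%R by rewrite -subr_gt0 -{2}(mul1r a) -mulrBl mulr_gt0 ?subr_gt0.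
  by rewrite /window/= in_itv/=; apply/andP; split; rewrite /m; lra.
by exists (K m m); exists m => //; exists m.
Qed.

Lemma Kinf_ge0 a : (0 < a)%R -> (0 <= Kinf K r a)%R.
Proof.
by move=> a0; apply: lb_le_inf; [exact: Kinf_nonempty|exact: Kinf_lbound].
Qed.

Lemma Kinf_le a x y : (0 < a)%R -> window r a x -> window r a y ->
  (Kinf K r a <= K x y)%R.
Proof.
move=> a0 ax ay; apply: ge_inf; first by exists 0%R; exact: Kinf_lbound.
by exists x => //; exists y.
Qed.

Lemma Hinf_le_Kinf a : (0 < a)%R -> (Hinf K r a <= a * Kinf K r a)%R.
Proof.
move=> a0; rewrite /Hinf ler_pM2l//; apply: lb_le_inf; first exact: Kinf_nonempty.
move=> _ [x ax [y ay <-]]; apply: ge_inf.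
  exists 0%R => _ [u + [v + <-]]; rewrite /= !in_itv/=.
  move=> /andP[au _] /andP[av _].
  by apply: K_ge0; [exact: lt_le_trans au|exact: lt_le_trans av].
by exists x; [exact: subset_itv_oo_cc|exists y => //; exact: subset_itv_oo_cc].
Qed.

(** The set where the infimum is less than [c] is the union, over the points
    [(x, y)] with [K x y < c], of the open sets of those [a] whose window contains
    both [x] and [y]. *)
Lemma measurable_Kinf :
  measurable_fun (`]x0, +oo[ : set (measurableTypeR R))
    (Kinf K r : measurableTypeR R -> measurableTypeR R).
Proof.
apply: (measurability (@RGenCInfty.G R)) => [|/= _ [_] [c] -> <-].
  exact: RGenCInfty.measurableE.
pose O := \bigcup_(z in [set z : R * R | (K z.1 z.2 < c)%R])
  (`](z.1 / r)%R, z.1[ `&` `](z.2 / r)%R, z.2[)%classic : set R.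
have oO : open O.
  by apply: bigcup_open => z _; apply: openI; exact: interval_open.
have r0 : (0 < r)%R by exact: lt_trans r_gt1.
have -> : `]x0, +oo[ `&` Kinf K r @^-1` `[c, +oo[ = `]x0, +oo[ `\` O.
  apply/seteqP; split=> a /=; rewrite !in_itv/= !andbT => -[x0a].
    have a0 : (0 < a)%R by exact: lt_trans x0a.
    move=> ca; split=> // -[[x y]] /= Kc []; rewrite !in_itv/= !ltr_pdivrMr//.
    rewrite (mulrC a) => /andP[xa ax] /andP[ya ay].
    suff : (Kinf K r a <= K x y)%R by move=> /(le_trans ca); rewrite leNgt Kc.
    by apply: Kinf_le => //; rewrite /window/= in_itv/= ?ax ?ay.
  have a0 : (0 < a)%R by exact: lt_trans x0a.
  move=> Oa; split=> //; rewrite leNgt; apply/negP => hc; apply: Oa.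
  have [_ [x xa [y ya <-]] Kc] := inf_lt (Kinf_nonempty _ a0) hc.
  exists (x, y) => //=; move: xa ya; rewrite /window/= !in_itv/=.
  by rewrite !ltr_pdivrMr// (mulrC a) => /andP[-> ->] /andP[-> ->].
by apply: measurableD => //; exact: open_measurable.
Qed.
End kernel_infimum.

(** * A weighted Cauchy-Schwarz inequality *)

Lemma fubini_tonelli_on d1 d2 (T1 : measurableType d1) (T2 : measurableType d2)
    (R : realType) (m1 : {sigma_finite_measure set T1 -> \bar R})
    (m2 : {sigma_finite_measure set T2 -> \bar R}) (D1 : set T1) (D2 : set T2)
    (f : T1 * T2 -> \bar R) : measurable D1 -> measurable D2 ->
  measurable_fun (D1 `*` D2) f ->
  (forall x y, D1 x -> D2 y -> 0 <= f (x, y)) ->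
  \int[m1]_(x in D1) \int[m2]_(y in D2) f (x, y) =
  \int[m2]_(y in D2) \int[m1]_(x in D1) f (x, y).
Proof.
move=> mD1 mD2 mf f0; pose h := f \_ (D1 `*` D2).
have hE x y : h (x, y) = if (x \in D1) && (y \in D2) then f (x, y) else 0.
  by rewrite /h /patch in_setX.
have h0 z : 0 <= h z.
  case: z => x y; rewrite hE; case: ifPn => // /andP[/set_mem ? /set_mem ?].
  exact: f0.
have mh : measurable_fun setT h.
  by apply/(measurable_restrictT _ _).1 => //; exact: measurableX.
transitivity (\int[m1]_x \int[m2]_y h (x, y)).
  rewrite integral_mkcond; apply: eq_integral => x _; rewrite /patch.
  case: ifPn => xD1; last by rewrite integral0_eq// => y _; rewrite hE (negPf xD1).
  rewrite integral_mkcond; apply: eq_integral => y _.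
  by rewrite /patch hE xD1.
rewrite fubini_tonelli//; apply/esym.
rewrite integral_mkcond; apply: eq_integral => y _; rewrite /patch.
case: ifPn => yD2; last by rewrite integral0_eq// => x _; rewrite hE (negPf yD2) andbF.
rewrite integral_mkcond; apply: eq_integral => x _.
by rewrite /patch hE yD2 andbT.
Qed.

(** With [0^-1 = +oo] the right-hand side is infinite when the weight vanishes,
    so that zeros of the weight need no separate treatment. *)
Lemma weighted_amgm {R : realType} (lam w : R) (g : \bar R) :
  (0 < lam)%R -> (0 <= w)%R -> 0 <= g ->
  (2 * lam)%:E * g <= w%:E * g ^+ 2 + (lam ^+ 2)%:E * w%:E^-1.
Proof.
move=> lam0; rewrite le_eqVlt => /predU1P[<- _|w0].
  by rewrite inve0 gt0_muley ?lte_fin ?exprn_gt0// mul0e add0e leey.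
case: g => [g| |]// g0.
- rewrite inver gt_eqF// -!EFin_expe -!EFinM -EFinD lee_fin.
  rewrite -subr_ge0.
  have -> : (w * g ^+ 2 + lam ^+ 2 / w - 2 * lam * g =
             w * (g - lam / w) ^+ 2)%R by field; rewrite gt_eqF.
  by rewrite mulr_ge0 ?sqr_ge0// ltW.
- rewrite inver gt_eqF// expe2 mulyy !gt0_muley ?lte_fin ?mulr_gt0// addye//.
Qed.

(** Bounding [2 lam g] by [w g^2 + lam^2 / w] and integrating over [a], then over
    [s], gives [2 lam c T <= (M + lam^2 T) k] with [k] the integral of [1 / w].
    Optimizing in [lam] is the Cauchy-Schwarz inequality for the product
    [g = (w^(1/2) g) w^(-1/2)]; it plays the role of Minkowski's inequality in
    [L^2(0, T)] for the integral of [g] over [a]. *)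
Lemma weighted_cauchy_schwarz {R : realType} (D : set (measurableTypeR R))
    (w : measurableTypeR R -> R)
    (g : measurableTypeR R * measurableTypeR R -> \bar R) (T M c : R) :
  measurable D -> measurable_fun D w -> (forall a, D a -> (0 <= w a)%R) ->
  measurable_fun (`[0%R, T]%classic `*` D) g -> (forall z, 0 <= g z) ->
  (0 < T)%R -> (0 <= M)%R -> (0 < c)%R ->
  (forall a, D a ->
    ((w a) ^+ 2)%:E * \int[lebesgue_measure]_(s in `[0%R, T]) g (s, a) ^+ 2
      <= M%:E) ->
  (forall s, `[0%R, T]%classic s ->
    c%:E <= \int[lebesgue_measure]_(a in D) g (s, a)) ->
  \int[lebesgue_measure]_(a in D) (w a)%:E^-1 < +oo ->
  (c ^+ 2 * T)%:E <=
    M%:E * (\int[lebesgue_measure]_(a in D) (w a)%:E^-1) ^+ 2.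
Proof.
move=> mD mw w0 mg g0 T0 M0 c0 gM cg.
set k := \int[_]_(a in _) _ => kfoo.
have k0 : 0 <= k by apply: integral_ge0 => a Da; rewrite inve_ge0 lee_fin w0.
pose U lam z := (w z.2)%:E * g z ^+ 2 + (lam ^+ 2)%:E * (w z.2)%:E^-1.
have mI : measurable (`[0%R, T] : set (measurableTypeR R)) by [].
have mgs a : D a ->
    measurable_fun (`[0%R, T] : set (measurableTypeR R)) (fun s => g (s, a)).
  move=> Da; rewrite (_ : (fun _ => _) = g \o pair^~ a)//.
  apply: (measurable_comp _ _ mg); [| |exact: measurable_funTS (pair2_measurable a)].
    exact: measurableX.
  by move=> _ [s sT <-].
have mU lam : measurable_fun (`[0%R, T]%classic `*` D) (U lam).
  have mwz : measurable_fun (`[0%R, T]%classic `*` D)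
      (fun z : measurableTypeR R * measurableTypeR R => w z.2).
    rewrite (_ : (fun _ => _) = w \o snd)//.
    apply: (measurable_comp mD _ mw); first by move=> _ [[s a] [_ Da] <-].
    exact: measurable_funTS measurable_snd.
  have mP : measurable ((`[0%R, T] : set (measurableTypeR R)) `*` D).
    exact: measurableX.
  apply: emeasurable_funD; first apply: emeasurable_funM.
  - exact/measurable_EFinP.
  - exact: measurable_sqre.
  - apply: measurable_funeM; apply: measurable_inve_EFin => //.
    by move=> [s a] [_ Da]; exact: w0.
have U0 lam s a : D a -> 0 <= U lam (s, a).
  move=> Da; rewrite adde_ge0// mule_ge0 ?inve_ge0 ?lee_fin ?w0 ?sqr_ge0//.
  by rewrite expe_ge0.
have mwi : measurable_fun D (fun a => (w a)%:E^-1) by exact: measurable_inve_EFin.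
have key lam : (0 < lam)%R -> (2 * lam * c * T)%:E <= (M + lam ^+ 2 * T)%:E * k.
  move=> lam0; have lam_ge0 := ltW lam0; have T_ge0 := ltW T0.
  have L0 : (0 <= M + lam ^+ 2 * T)%R by rewrite addr_ge0// mulr_ge0 ?sqr_ge0// ltW.
  apply: (@le_trans _ _ (\int[lebesgue_measure]_(s in `[0%R, T])
      \int[lebesgue_measure]_(a in D) U lam (s, a))).
    apply: (@le_trans _ _
        (\int[lebesgue_measure]_(s in `[0%R, T]) (2 * lam * c)%:E)).
      by rewrite integral_cst//= lebesgue_measure_itv/= lte_fin T0 -EFinB subr0 EFinM.
    apply: le_integral_nonmeasurable => s sT.
      by rewrite lee_fin !mulr_ge0// ltW.
    have mgD : measurable_fun D (fun a => g (s, a)).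
      rewrite (_ : (fun _ => _) = g \o pair s)//.
      apply: (measurable_comp _ _ mg); [| |exact: measurable_funTS (pair1_measurable s)].
        exact: measurableX.
      by move=> _ [a Da <-].
    apply: (@le_trans _ _ (\int[lebesgue_measure]_(a in D)
        ((2 * lam)%:E * g (s, a)))).
      rewrite ge0_integralZl//; last by rewrite lee_fin mulr_ge0// ltW.
      by rewrite EFinM lee_wpmul2l ?cg// lee_fin mulr_ge0// ltW.
    apply: le_integral_nonmeasurable => a Da.
      by rewrite mule_ge0// lee_fin mulr_ge0// ltW.
    exact: weighted_amgm (w0 _ Da) (g0 _).
  rewrite fubini_tonelli_on//; [|exact: mU|by move=> s a _; exact: U0].
  have wi0 a : D a -> 0 <= (w a)%:E^-1 by move=> Da; rewrite inve_ge0 lee_fin w0.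
  rewrite /k -ge0_integralZl//.
  apply: le_integral_nonmeasurable => a Da.
    by apply: integral_ge0 => s _; exact: U0.
  have mg2 : measurable_fun (`[0%R, T] : set (measurableTypeR R))
      (fun s => g (s, a) ^+ 2) by apply: measurable_sqre; exact: mgs.
  have g20 s : 0 <= g (s, a) ^+ 2 by exact: expe_ge0.
  rewrite /U/=.
  rewrite ge0_integralD//; last 3 first.
  - by move=> s _; rewrite mule_ge0 ?g20// lee_fin w0.
  - exact: measurable_funeM.
  - by move=> s _; rewrite mule_ge0 ?wi0// lee_fin sqr_ge0.
  rewrite ge0_integralZl//; last 2 first.
  - by move=> s _; exact: g20.
  - by rewrite lee_fin w0.
  rewrite integral_cst//= lebesgue_measure_itv/= lte_fin T0 -EFinB subr0.
  rewrite EFinD ge0_muleDl ?lee_fin ?mulr_ge0 ?sqr_ge0 ?(ltW T0)//.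
  rewrite muleAC -EFinM leeD2r//.
  have := gM _ Da; have := w0 _ Da; rewrite le_eqVlt => /predU1P[<- _|wa0].
    by rewrite mul0e mule_ge0 ?lee_fin// inve0 leey.
  rewrite inver gt_eqF// => gMa.
  by rewrite lee_pdivlMr// muleAC -EFinM -expr2.
have kfin : k \is a fin_num by rewrite ge0_fin_numE.
have kk0 : (0 <= fine k)%R by exact: fine_ge0.
move: key; rewrite -(fineK kfin); move: (fine k) kk0 => kk kk0 key.
rewrite -EFin_expe -EFinM lee_fin.
move: kk0; rewrite le_eqVlt => /predU1P[kkE|kk0].
  have := key 1%R ltr01; rewrite -kkE mule0 lee_fin leNgt.
  by rewrite !mulr_gt0.
(* [c / kk] maximizes [2 lam c - lam^2 kk] *)
have := key (c / kk)%R (divr_gt0 c0 kk0); rewrite -EFinM lee_fin.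
have -> : (2 * (c / kk) * c * T = 2 * (c ^+ 2 * T) / kk)%R by field; rewrite gt_eqF.
have -> : ((M + (c / kk) ^+ 2 * T) * kk = M * kk + c ^+ 2 * T / kk)%R.
  by field; rewrite gt_eqF.
rewrite -lerBlDr -mulrBl ler_pdivrMr//.
by rewrite mulr2n; lra.
Qed.

(** * The mass of the windows *)

Lemma measurable_window_set {R : realType} (r : R) :
  measurable [set z : measurableTypeR R * measurableTypeR R | window r z.1 z.2].
Proof.
rewrite (_ : [set _ | _] = (fun z : measurableTypeR R * measurableTypeR R =>
    (z.1 < z.2)%R && (z.2 < r * z.1)%R) @^-1` [set true]); last first.
  by apply/seteqP; split=> z /=; rewrite /window/= in_itv.
have m1 := @measurable_fst _ _ (measurableTypeR R) (measurableTypeR R).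
have m2 := @measurable_snd _ _ (measurableTypeR R) (measurableTypeR R).
rewrite -[X in measurable X]setTI; apply: measurable_and => //.
  exact: measurable_fun_ltr.
apply: measurable_fun_ltr => //.
exact: measurable_funM.
Qed.

(** A point [x > x0] lies in the window of [a > x0] exactly when
    [max x0 (x / r) < a < x]; the length of this interval is the integrand on the
    right. *)
Lemma integral_windows {R : realType} (r x0 : R) (x0_gt0 : (0 < x0)%R)
    (r_gt1 : (1 < r)%R)
    (mu : {finite_measure set (measurableTypeR R) -> \bar R}) :
  \int[lebesgue_measure]_(a in `]x0, +oo[) mu (window r a) =
  \int[mu]_(x in `]x0, +oo[) (Num.min (x - x0) (x - x / r))%:E.
Proof.
have mD : measurable (`]x0, +oo[ : set (measurableTypeR R)) by [].
pose E := [set z : measurableTypeR R * measurableTypeR R | window r z.1 z.2].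
have mE : measurable E := measurable_window_set r.
have r0 : (0 < r)%R by exact: lt_trans r_gt1.
have sub (a : R) : (x0 < a)%R -> window r a `<=` `]x0, +oo[.
  by move=> x0a x; rewrite /window/= !in_itv/= andbT => /andP[+ _]; exact: lt_trans.
transitivity (\int[lebesgue_measure]_(a in `]x0, +oo[)
    \int[mu]_(x in `]x0, +oo[) (\1_E (a, x))%:E).
  apply: eq_integral => a; rewrite inE/= in_itv/= andbT => x0a.
  rewrite (eq_integral (fun x : measurableTypeR R => (\1_(window r a) x)%:E)); last first.
    by move=> x _; rewrite !indicE.
  rewrite integral_indic//; last exact: measurable_itv.
  by rewrite setIidl//; exact: sub.
rewrite (@fubini_tonelli_on _ _ _ _ _ _ _ _ _
  (fun z : measurableTypeR R * measurableTypeR R => (\1_E z)%:E))//; last first.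
  by apply/measurable_EFinP; exact: measurable_indic.
apply: eq_integral => x; rewrite inE/= in_itv/= andbT => x0x.
have x_gt0 : (0 < x)%R by exact: lt_trans x0x.
rewrite (eq_integral (fun a : measurableTypeR R =>
  (\1_(`](x / r)%R, x[%classic : set R) a)%:E)); last first.
  move=> a _; rewrite !indicE.
  suff -> : ((a, x) \in E) = (a \in (`](x / r)%R, x[%classic : set R)) by [].
  apply/idP/idP; rewrite !inE /E /window/= !in_itv/= ltr_pdivrMr// mulrC;
    by move=> /andP[-> ->].
rewrite integral_indic//.
rewrite (_ : _ `&` _ = `](Num.max x0 (x / r))%R, x[%classic); last first.
  apply/seteqP; split=> a /=; rewrite !in_itv/= gt_max.
    by move=> [/andP[-> ->] /andP[-> _]].
  by move=> /andP[/andP[-> ->] ->].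
have xr : (x / r < x)%R by rewrite ltr_pdivrMr// ltr_pMr.
rewrite /= lebesgue_measure_itv/= lte_fin gt_max x0x xr -EFinB.
congr (_%:E); rewrite /Num.min /Num.max.
by case: (ltP x0 (x / r)%R) => ?; case: (ltP (x - x0)%R (x - x / r)%R) => ?; lra.
Qed.

(** Both [x - x0] and [x - x / r = (1 - 1/r) x] are at least
    [(1 - 1/r) (x - x0)]. *)
Lemma le_integral_windows {R : realType} (r x0 : R) (x0_gt0 : (0 < x0)%R)
    (r_gt1 : (1 < r)%R)
    (mu : {finite_measure set (measurableTypeR R) -> \bar R}) :
  ((r - 1) / r)%:E * \int[mu]_(x in `]x0, +oo[) (x - x0)%:E <=
  \int[lebesgue_measure]_(a in `]x0, +oo[) mu (window r a).
Proof.
rewrite integral_windows//.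
have r0 : (0 < r)%R by exact: lt_trans r_gt1.
have rr0 : (0 <= (r - 1) / r)%R by rewrite divr_ge0 ?subr_ge0 ?ltW.
have D0 x : `]x0, +oo[%classic x -> (0 <= x - x0)%R.
  by rewrite /= in_itv/= andbT subr_ge0 => /ltW.
rewrite -ge0_integralZl//; last first.
  by apply/measurable_EFinP; exact: measurable_funB.
apply: le_integral_nonmeasurable => x xD.
  by rewrite -EFinM lee_fin mulr_ge0// D0.
have := D0 _ xD; move=> xx0.
have rr1 : ((r - 1) / r <= 1)%R by rewrite ler_pdivrMr// mul1r gerBl.
rewrite -EFinM lee_fin le_min ler_piMl//=.
have -> : (x - x / r = (r - 1) / r * x)%R by field; rewrite gt_eqF.
by rewrite ler_wpM2l// gerBl ltW.
Qed.

Section joint_measurability.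
Context {R : realType}.
Variables (f : R -> {measure set (measurableTypeR R) -> \bar R}) (x0 C : R).
Hypothesis mf : forall A : set (measurableTypeR R), measurable A ->
  A `<=` `]x0, +oo[ ->
  measurable_fun (`[0%R, +oo[ : set (measurableTypeR R))
    (f ^~ A : measurableTypeR R -> \bar R).
Hypothesis f_le : forall t : R, (0 <= t)%R -> f t `]x0, +oo[%classic <= C%:E.

Let D : set (measurableTypeR R) := `]x0, +oo[%classic.
Let mD : measurable D. Proof. exact: measurable_itv. Qed.

(** The family is extended by [f 0] to negative times and read on pairs
    [(s, a)], in order to be a finite kernel from the plane: integrating the
    indicator of the window of [a] against it is then jointly measurable. *)
Definition tail_family (z : measurableTypeR R * measurableTypeR R) :
    {measure set (measurableTypeR R) -> \bar R} :=
  mrestr (f (Num.max 0%R z.1)) mD.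

Let measurable_tail_family (U : set (measurableTypeR R)) : measurable U ->
  measurable_fun setT (tail_family ^~ U).
Proof.
move=> mU; rewrite /tail_family /mrestr.
rewrite (_ : (fun _ => _) = (f ^~ (U `&` D)) \o
  (fun z : measurableTypeR R * measurableTypeR R => Num.max 0%R z.1))//.
apply: (@measurable_comp _ _ _ _ _ _
  (`[0%R, +oo[%classic : set (measurableTypeR R))) => //.
- by move=> _ [z _ <-] /=; rewrite in_itv/= andbT le_max lexx.
- apply: mf; [exact: measurableI|exact: subIsetr].
- by apply: measurable_maxr => //; exact: measurable_fst.
Qed.

HB.instance Definition _ := @isKernel.Build _ _ _ _ R tail_family measurable_tail_family.

Let tail_family_uub : measure_fam_uub tail_family.
Proof.
exists (C + 1)%R => z; rewrite /tail_family/= /mrestr setTI.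
rewrite (@le_lt_trans _ _ C%:E) ?lte_fin ?ltrDl//.
by apply: f_le; rewrite le_max lexx.
Qed.

HB.instance Definition _ :=
  @Kernel_isFinite.Build _ _ _ _ R tail_family tail_family_uub.

Lemma measurable_windows (r T : R) :
  measurable_fun ((`[0%R, T] : set (measurableTypeR R)) `*` D)
    (fun z => f z.1 (window r z.2)).
Proof.
pose E := [set z : measurableTypeR R * measurableTypeR R | window r z.1 z.2].
have mE : measurable E := measurable_window_set r.
have mG : measurable_fun setT (fun z => tail_family z (window r z.2)).
  rewrite (_ : (fun _ => _) = (fun z => \int[tail_family z]_x
    (\1_E (z.2, x))%:E)); last first.
    apply/funext => z.
    rewrite (eq_integral (fun x : measurableTypeR R =>
      (\1_(window r z.2) x)%:E)); last first.
      by move=> x _; rewrite !indicE.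
    by rewrite integral_indic ?setIT//; exact: measurable_itv.
  apply: (measurable_fun_integral_finite_kernel
    (fun z : measurableTypeR R * measurableTypeR R * measurableTypeR R =>
      (\1_E (z.1.2, z.2))%:E)).
    by move=> z; rewrite lee_fin.
  apply/measurable_EFinP.
  rewrite (_ : (fun _ => _) = \1_E \o
    (fun z : measurableTypeR R * measurableTypeR R * measurableTypeR R =>
      (z.1.2, z.2)))//.
  apply: measurableT_comp => //.
  apply: measurable_fun_pair; last exact: measurable_snd.
  apply: (@measurableT_comp _ _ _ _ _ _ snd); first exact: measurable_snd.
  exact: measurable_fst.
apply: (@eq_measurable_fun _ _ _ _ _ (fun z => tail_family z (window r z.2))).
  move=> [s a] /set_mem[]; rewrite /D/= !in_itv/= andbT => /andP[s0 _] x0a.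
  rewrite /tail_family /mrestr/= (max_idPr s0) setIidl//.
  by move=> x; rewrite /window/D/= !in_itv/= andbT => /andP[+ _]; exact: lt_trans.
exact: measurable_funTS.
Qed.

End joint_measurability.

(** * Truncated moments of weak solutions *)

Lemma min_test_function {R : realType} (A : R) : (0 < A)%R ->
  bounded_test_function (fun x : R => Num.min x A).
Proof.
move=> A0; split.
- exact: measurable_minr.
- by move=> x x0; rewrite le_min !ltW.
- by exists A => x _; rewrite ge_min lexx orbT.
Qed.

Lemma Delta_min_le0 {R : realType} (A x y : R) : (0 < A)%R -> (0 < x)%R ->
  (0 < y)%R -> (Delta (fun x => Num.min x A) x y <= 0)%R.
Proof.
rewrite /Delta => *.
by case: (leP x A) => ?; case: (leP y A) => ?; case: (leP (x + y)%R A) => ?; lra.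
Qed.

(** Two clusters larger than [A] count for [2 A] before merging and for [A]
    afterwards. *)
Lemma Delta_min_ge {R : realType} (A x y : R) : (0 < A)%R -> (A < x)%R ->
  (A < y)%R -> Delta (fun x => Num.min x A) x y = (- A)%R.
Proof.
rewrite /Delta => *.
by case: (leP x A) => ?; case: (leP y A) => ?; case: (leP (x + y)%R A) => ?; lra.
Qed.

Lemma moment1E {R : realType} (m : {measure set (measurableTypeR R) -> \bar R}) :
  moment 1 m = \int[m]_(x in `]0%R, +oo[) x%:E.
Proof.
apply: eq_integral => x; rewrite inE/= in_itv/= andbT => x0.
by rewrite powRr1// ltW.
Qed.

Section truncated_moments.
Context {R : realType}.
Variables (m : {measure set (measurableTypeR R) -> \bar R}) (A : R).
Hypothesis A_gt0 : (0 < A)%R.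

Lemma truncated_moment_ge0 :
  0 <= \int[m]_(x in `]0%R, +oo[) (Num.min x A)%:E.
Proof.
apply: integral_ge0 => x /=; rewrite in_itv/= andbT => x0.
by rewrite lee_fin le_min !ltW.
Qed.

Lemma truncated_moment_le :
  \int[m]_(x in `]0%R, +oo[) (Num.min x A)%:E <= moment 1 m.
Proof.
rewrite moment1E; apply: le_integral_nonmeasurable => x /=.
  by rewrite in_itv/= andbT => x0; rewrite lee_fin le_min !ltW.
by rewrite lee_fin ge_min lexx.
Qed.

Lemma tail_measure_le :
  A%:E * m `]A, +oo[%classic <= \int[m]_(x in `]0%R, +oo[) (Num.min x A)%:E.
Proof.
rewrite -integral_cst//.
apply: (@le_trans _ _ (\int[m]_(x in `]A, +oo[) (Num.min x A)%:E)).
  apply: le_integral_nonmeasurable => x /=; first by rewrite lee_fin ltW.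
  by rewrite in_itv/= andbT => Ax; rewrite lee_fin le_min lexx ltW.
apply: ge0_subset_integral => //.
- apply/measurable_EFinP; exact: measurable_minr.
- move=> x /=; rewrite in_itv/= andbT => x0.
  by rewrite lee_fin le_min !ltW.
- by apply: subset_itvr; rewrite bnd_simp ltW.
Qed.

Lemma moment1_split : moment 1 m =
  \int[m]_(x in `]0%R, +oo[) (Num.min x A)%:E +
  \int[m]_(x in `]A, +oo[) (x - A)%:E.
Proof.
have AP : `]A, +oo[ `<=` (`]0%R, +oo[%classic : set R).
  by apply: subset_itvr; rewrite bnd_simp ltW.
rewrite -[X in \int[m]_(x in X) (x - A)%:E](setIidr AP) integral_mkcondr.
rewrite -ge0_integralD//.
- rewrite moment1E; apply: eq_integral => x; rewrite inE/= in_itv/= andbT => x0.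
  rewrite /patch mem_setE in_itv/= andbT; case: ltP => Ax; rewrite ?adde0//.
  by rewrite -EFinD addrC subrK.
- by move=> x /=; rewrite in_itv/= andbT => x0; rewrite lee_fin le_min !ltW.
- by apply/measurable_EFinP; exact: measurable_minr.
- move=> x _; rewrite /patch mem_setE in_itv/= andbT; case: ltP => // Ax.
  by rewrite lee_fin subr_ge0 ltW.
- apply: measurable_funTS; apply/(measurable_restrictT _ _).1 => //.
  by apply/measurable_EFinP; exact: measurable_funB.
Qed.

End truncated_moments.

Section weak_solution_estimates.
Context {R : realType}.
Variables (K : R -> R -> R) (r : R).
Variable f : R -> {measure set (measurableTypeR R) -> \bar R}.
Hypothesis K_ge0 : forall x y : R, (0 < x)%R -> (0 < y)%R -> (0 <= K x y)%R.
Hypothesis r_gt1 : (1 < r)%R.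
Hypothesis f_sol : weak_solution K f.
Hypothesis M1_fin : moment 1 (f 0%R) < +oo.

Let P : set (measurableTypeR R) := `]0%R, +oo[%classic.

Lemma integral_dissipation_ge0 (A t : R) : (0 < A)%R ->
  0 <= \int[lebesgue_measure]_(s in `[0%R, t])
    \int[f s]_(x in P) \int[f s]_(y in P)
      (- Delta (fun x => Num.min x A) x y * K x y)%:E.
Proof.
move=> A0; have PE (x : R) : P x -> (0 < x)%R by rewrite /P/= in_itv/= andbT.
apply: integral_ge0 => s _; apply: integral_ge0 => x /PE x0.
apply: integral_ge0 => y /PE y0.
by rewrite lee_fin mulr_ge0 ?K_ge0// oppr_ge0 Delta_min_le0.
Qed.

(** The dissipated part is moved to the left so that every term is nonnegative.
    It is finite, since the truncated moment of [f t] could not be nonnegative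
    otherwise. *)
Lemma truncated_moment_dissipation (A t : R) : (0 < A)%R -> (0 <= t)%R ->
  \int[f t]_(x in P) (Num.min x A)%:E +
  (2^-1)%:E * \int[lebesgue_measure]_(s in `[0%R, t])
    \int[f s]_(x in P) \int[f s]_(y in P)
      (- Delta (fun x => Num.min x A) x y * K x y)%:E =
  \int[f 0%R]_(x in P) (Num.min x A)%:E.
Proof.
move=> A0 t0; have [_ _ /(_ _ (min_test_function _ A0) _ t0)] := f_sol.
have PE (x : R) : P x -> (0 < x)%R by rewrite /P/= in_itv/= andbT.
have D0 x y : P x -> P y ->
    0 <= (- Delta (fun x : R => Num.min x A) x y * K x y)%:E.
  move=> /PE x0 /PE y0.
  by rewrite lee_fin mulr_ge0 ?K_ge0// oppr_ge0 Delta_min_le0.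
set J := \int[lebesgue_measure]_(s in _) _ => eqt.
set J' := \int[lebesgue_measure]_(s in _) _.
have J'0 : 0 <= J' := integral_dissipation_ge0 A t A0.
have JJ' : J = - J'.
  rewrite /J /J' -integral_ge0N; last first.
    move=> s _; apply: integral_ge0 => x Px.
    by apply: integral_ge0 => y Py; exact: D0.
  apply: eq_integral => s _; rewrite -integral_ge0N; last first.
    by move=> x Px; apply: integral_ge0 => y Py; exact: D0.
  apply: eq_integral => x /set_mem Px; rewrite -integral_ge0N; last first.
    by move=> y Py; exact: D0.
  by apply: eq_integral => y /set_mem Py; rewrite -EFinN mulNr opprK.
rewrite JJ' in eqt.
have := truncated_moment_ge0 (f t) _ A0; rewrite -/P eqt.
have := truncated_moment_ge0 (f 0%R) _ A0; rewrite -/P.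
have := truncated_moment_le (f 0%R) _ A0; rewrite -/P.
move=> /le_lt_trans /(_ M1_fin).
case: (\int[f 0%R]_(x in P) (Num.min x A)%:E) => [u| |]// _ _.
move: J'0; case: J' {JJ' eqt J} => [j| |]//.
  by move=> _ _; rewrite muleN -EFinM -EFinN -!EFinD subrK.
by move=> _; rewrite muleN gt0_muley// lte_fin invr_gt0.
Qed.

Lemma truncated_moment_noninc (A t : R) : (0 < A)%R -> (0 <= t)%R ->
  \int[f t]_(x in P) (Num.min x A)%:E <= \int[f 0%R]_(x in P) (Num.min x A)%:E.
Proof.
move=> A0 t0; rewrite -(truncated_moment_dissipation _ _ A0 t0) leeDl//.
by rewrite mule_ge0 ?lee_fin ?invr_ge0// integral_dissipation_ge0.
Qed.

Lemma integral_dissipation_le (A t : R) : (0 < A)%R -> (0 <= t)%R ->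
  \int[lebesgue_measure]_(s in `[0%R, t])
    \int[f s]_(x in P) \int[f s]_(y in P)
      (- Delta (fun x => Num.min x A) x y * K x y)%:E <= 2%:E * moment 1 (f 0%R).
Proof.
move=> A0 t0; rewrite -lee_pdivrMl//.
apply: le_trans (truncated_moment_le (f 0%R) _ A0).
rewrite -(truncated_moment_dissipation _ _ A0 t0) leeDr//.
exact: truncated_moment_ge0.
Qed.

(** The bound is uniform in time, which makes the family of the tails of the
    [f t] a finite kernel. *)
Lemma tail_measure_bound (x0 t : R) : (0 < x0)%R -> (0 <= t)%R ->
  f t `]x0, +oo[%classic <= (fine (moment 1 (f 0%R)) / x0)%:E.
Proof.
move=> x00 t0; rewrite mulrC EFinM lee_pdivlMl// fineK.
  apply: le_trans (tail_measure_le _ _ x00) _.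
  apply: le_trans (truncated_moment_noninc _ _ x00 t0) _.
  exact: truncated_moment_le.
by rewrite ge0_fin_numE// /moment integral_ge0// => x _; rewrite lee_fin powR_ge0.
Qed.

(** Only the collisions inside the window of [a] are kept in the dissipation of
    the moment truncated at [a]; each of them contributes
    [a K x y >= a Kinf K r a]. *)
Lemma window_square_bound (a t : R) : (0 < a)%R -> (0 <= t)%R ->
  (a * Kinf K r a)%:E *
    \int[lebesgue_measure]_(s in `[0%R, t]) f s (window r a) ^+ 2 <=
  2%:E * moment 1 (f 0%R).
Proof.
move=> a0 t0; have k0 := Kinf_ge0 _ _ r_gt1 K_ge0 _ a0.
set k := Kinf K r a in k0 *.
have mW : measurable (window r a : set (measurableTypeR R)) by exact: measurable_itv.
have mP : measurable P by exact: measurable_itv.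
have WP : window r a `<=` P.
  by move=> x; rewrite /window/P/= !in_itv/= andbT => /andP[+ _]; exact: lt_trans.
have ak0 : 0 <= (a * k)%:E by rewrite lee_fin mulr_ge0// ltW.
have mfW : measurable_fun (`[0%R, t] : set (measurableTypeR R))
    (fun s : measurableTypeR R => f s (window r a)).
  have [mf _ _] := f_sol.
  apply: measurable_funS (mf _ mW WP) => //.
  by move=> s /=; rewrite !in_itv/= andbT => /andP[].
apply: le_trans (integral_dissipation_le _ _ a0 t0).
rewrite -ge0_integralZl//; last 2 first.
- exact: measurable_sqre.
- by move=> s _; exact: expe_ge0.
apply: le_integral_nonmeasurable => s _.
  by rewrite mule_ge0// expe_ge0.
have int1 : \int[f s]_(x in P) (\1_(window r a) x)%:E = f s (window r a).
  by rewrite integral_indic// setIidl.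
have m1 : measurable_fun P (fun x : measurableTypeR R => (\1_(window r a) x : R)%:E).
  by apply/measurable_EFinP; exact: measurable_indic.
rewrite expe2 muleA -[X in _ * X]int1 -ge0_integralZl//; last first.
  by rewrite mule_ge0.
apply: le_integral_nonmeasurable => x Px.
  by rewrite !mule_ge0// lee_fin.
rewrite muleAC -[X in _ * X]int1 -ge0_integralZl//; last first.
  by rewrite mule_ge0// lee_fin.
apply: le_integral_nonmeasurable => y Py.
  by rewrite !mule_ge0// lee_fin.
rewrite -!EFinM lee_fin !indicE.
have PE (u : R) : P u -> (0 < u)%R by rewrite /P/= in_itv/= andbT.
have x0 := PE _ Px; have y0 := PE _ Py.
have D0 : (0 <= - Delta (fun x => Num.min x a) x y * K x y)%R.
  by rewrite mulr_ge0 ?K_ge0// oppr_ge0 Delta_min_le0.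
have [/set_mem xW|_] := boolP (x \in _); last by rewrite mulr0 mul0r.
have [/set_mem yW|_] := boolP (y \in _); last by rewrite mulr0.
have WE (u : R) : window r a u -> (a < u)%R.
  by rewrite /window/= in_itv/= => /andP[].
rewrite !mulr1 (Delta_min_ge _ _ _ a0 (WE _ xW) (WE _ yW)) opprK.
by rewrite ler_pM2l//; exact: (Kinf_le _ _ K_ge0).
Qed.

(** The total mass does not decrease by hypothesis and its part truncated at
    [x0] does not increase; the latter is finite and can be subtracted. *)
Lemma excess_moment_le (x0 s : R) : (0 < x0)%R -> (0 <= s)%R ->
  moment 1 (f 0%R) <= moment 1 (f s) ->
  \int[f 0%R]_(x in `]x0, +oo[) (x - x0)%:E <=
  \int[f s]_(x in `]x0, +oo[) (x - x0)%:E.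
Proof.
move=> x00 s0; rewrite !(moment1_split _ _ x00).
have := truncated_moment_noninc _ _ x00 s0; rewrite -/P.
have := truncated_moment_ge0 (f 0%R) _ x00; rewrite -/P.
have := truncated_moment_le (f 0%R) _ x00; rewrite -/P.
move=> /le_lt_trans /(_ M1_fin).
case: (\int[f 0%R]_(x in P) (Num.min x x0)%:E) => [u| |]// _ _ us.
by move=> /le_trans /(_ (leeD2r _ us)); rewrite leeD2lE.
Qed.

End weak_solution_estimates.

(** * The gelation time *)

Lemma excess_moment_gt0 {R : realType}
    (m : {measure set (measurableTypeR R) -> \bar R}) (x0 : R) :
  0 < m `]x0, +oo[%classic -> 0 < \int[m]_(x in `]x0, +oo[) (x - x0)%:E.
Proof.
set D : set (measurableTypeR R) := `]x0, +oo[%classic.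
have mD : measurable D by exact: measurable_itv.
have DE (x : R) : D x -> (0 < x - x0)%R by rewrite /D/= in_itv/= andbT subr_gt0.
have i0 : 0 <= \int[m]_(x in D) (x - x0)%:E.
  by apply: integral_ge0 => x /DE/ltW.
move=> mD0; rewrite lt0e i0 andbT; apply/eqP => int0.
have mx : measurable_fun D (fun x : measurableTypeR R => (x - x0)%:E).
  by apply/measurable_EFinP; exact: measurable_funB.
have /(ae_eq_integral_abs m mD mx) : \int[m]_(x in D) `|(x - x0)%:E| = 0.
  rewrite -[RHS]int0; apply: eq_integral => x /set_mem /DE xx0.
  by rewrite gee0_abs// lee_fin ltW.
move=> [N [mN N0 DN]]; suff mDle : m D <= m N.
  by move: mD0; rewrite ltNge (le_trans mDle) ?N0.
apply: le_measure; rewrite ?inE// => x Dx; apply: DN => /= /(_ Dx) /eqP.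
by rewrite eqe gt_eqF ?DE.
Qed.

Lemma no_mass_loss_before_gelation {R : realType}
    (f : R -> {measure set (measurableTypeR R) -> \bar R}) (s : R) :
  (0 <= s)%R -> s%:E < Tgel f -> moment 1 (f 0%R) <= moment 1 (f s).
Proof.
move=> s0 sT; rewrite leNgt; apply/negP => ms; move: sT; rewrite ltNge.
by move/negP; apply; apply: ereal_inf_lbound; exists s.
Qed.

Theorem theorem3 (R : realType) (K : R -> R -> R) (HK : coagulation_kernel K)
    (x0 r : R) (x0_gt0 : (0 < x0)%R) (r_gt1 : (1 < r)%R)
    (kappa_fin : kappa K r x0 < +oo)
    (f : R -> {measure set (measurableTypeR R) -> \bar R})
    (f_sol : weak_solution K f)
    (M1_fin : moment 1 (f 0%R) < +oo)
    (f0_gt0 : 0 < f 0%R `]x0, +oo[%classic) :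
  Tgel f <=
    2%:E * kappa K r x0 ^+ 2 * ((r / (r - 1)) ^+ 2)%:E *
    (moment 1 (f 0%R) /
     (\int[f 0%R]_(x in `]x0, +oo[) (x - x0)%:E) ^+ 2).
Proof.
have [_ K_ge0 _] := HK.
have r0 : (0 < r)%R by exact: lt_trans r_gt1.
pose D : set (measurableTypeR R) := `]x0, +oo[%classic.
have mD : measurable D by exact: measurable_itv.
have DE (a : R) : D a -> (x0 < a)%R by rewrite /D/= in_itv/= andbT.
have D0 (a : R) : D a -> (0 < a)%R by move=> /DE; exact: lt_trans.
pose w (a : measurableTypeR R) : R := Num.sqrt (a * Kinf K r a).
have aK0 a : D a -> (0 <= a * Kinf K r a)%R.
  by move=> /D0 a0; rewrite mulr_ge0 ?Kinf_ge0// ltW.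
have mw : measurable_fun D w.
  apply: (measurableT_comp (continuous_measurable_fun (@sqrt_continuous R))).
  by apply: measurable_funM => //; exact: measurable_Kinf.
have kappa_ge : \int[lebesgue_measure]_(a in D) (w a)%:E^-1 <= kappa K r x0.
  apply: le_integral_nonmeasurable => a Da; first by rewrite inve_ge0 lee_fin sqrtr_ge0.
  apply: le_inve; rewrite lee_fin ?sqrtr_ge0//.
  by apply: ler_wsqrtr; apply: Hinf_le_Kinf => //; exact: D0.
have kappa0 : 0 <= kappa K r x0.
  by apply: integral_ge0 => a _; rewrite inve_ge0 lee_fin sqrtr_ge0.
have M1_ge0 : 0 <= moment 1 (f 0%R).
  by apply: integral_ge0 => x _; rewrite lee_fin powR_ge0.
have := excess_moment_gt0 _ _ f0_gt0; set m := integral _ _ _ => m_gt0.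
have m_fin : m < +oo.
  apply: le_lt_trans M1_fin; rewrite (moment1_split _ _ x0_gt0).
  by rewrite leeDr// truncated_moment_ge0.
set B := _ * (_ / _); rewrite leNgt; apply/negP => BT.
have [kfin mfin Mfin] : [/\ kappa K r x0 \is a fin_num, m \is a fin_num &
    moment 1 (f 0%R) \is a fin_num] by rewrite !ge0_fin_numE ?(ltW m_gt0).
pose k := fine (kappa K r x0); pose u := fine m; pose M := fine (moment 1 (f 0%R)).
have u0 : (0 < u)%R by rewrite fine_gt0// m_gt0.
have M0 : (0 <= M)%R by exact: fine_ge0.
have BE : B = (2 * k ^+ 2 * (r / (r - 1)) ^+ 2 * (M / u ^+ 2))%:E.
  rewrite /B -(fineK kfin) -(fineK mfin) -(fineK Mfin) -/k -/u -/M.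
  by rewrite -!EFin_expe inver gt_eqF ?exprn_gt0// -!EFinM.
(* a time beyond the bound up to which no mass is lost *)
have [T BT1 TT] : exists2 T : R, B < T%:E & T%:E < Tgel f.
  case: (Tgel f) BT => [l| |]; rewrite BE ?lte_fin//= => bl.
    exists ((2 * k ^+ 2 * (r / (r - 1)) ^+ 2 * (M / u ^+ 2) + l) / 2)%R.
      by rewrite lte_fin midf_lt.
    by rewrite lte_fin midf_lt.
  exists (2 * k ^+ 2 * (r / (r - 1)) ^+ 2 * (M / u ^+ 2) + 1)%R.
    by rewrite lte_fin ltrDl.
  by rewrite ltey.
have T0 : (0 < T)%R.
  rewrite -lte_fin (le_lt_trans _ BT1)// BE lee_fin.
  apply: mulr_ge0; last by rewrite divr_ge0 ?sqr_ge0.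
  by do 2 ?[apply: mulr_ge0; rewrite ?sqr_ge0//].
pose g (z : measurableTypeR R * measurableTypeR R) := f z.1 (window r z.2).
have [mf _ _] := f_sol.
have mg : measurable_fun ((`[0%R, T] : set (measurableTypeR R)) `*` D) g.
  apply: (@measurable_windows _ f x0 (M / x0)).
    move=> A mA AD; apply: mf => //.
    by move=> x /AD /D0; rewrite /= in_itv/= andbT.
  by move=> t t0; exact: (tail_measure_bound _ _ K_ge0 f_sol M1_fin).
have c0 : (0 < (r - 1) / r * u)%R by rewrite !mulr_gt0 ?invr_gt0 ?subr_gt0.
have g_large s : `[0%R, T]%classic s ->
    ((r - 1) / r * u)%:E <= \int[lebesgue_measure]_(a in D) g (s, a).
  rewrite /= in_itv/= => /andP[s0 sT].
  have ms : moment 1 (f 0%R) <= moment 1 (f s).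
    by apply: no_mass_loss_before_gelation => //; apply: le_lt_trans TT; rewrite lee_fin.
  have fsD : f s D < +oo.
    apply: le_lt_trans (tail_measure_bound _ _ K_ge0 f_sol M1_fin _ _ x0_gt0 s0) _.
    exact: ltey.
  have := le_integral_windows r x0 x0_gt0 r_gt1 (mfrestr mD fsD).
  rewrite (eq_measure_integral (f s)); last first.
    by move=> A _ AD; rewrite /= /mfrestr /mrestr setIidl.
  rewrite [leRHS](eq_integral (fun a : measurableTypeR R => g (s, a))); last first.
    move=> a /set_mem /DE x0a; rewrite /= /mfrestr /mrestr setIidl// => x.
    by rewrite /window/D/= !in_itv/= andbT => /andP[+ _]; exact: lt_trans.
  apply: le_trans; rewrite EFinM lee_wpmul2l//.
    by rewrite lee_fin divr_ge0 ?subr_ge0 ?(ltW r0) ?(ltW r_gt1).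
  rewrite /u (fineK mfin).
  exact: (excess_moment_le _ _ K_ge0 f_sol M1_fin _ _ x0_gt0 s0 ms).
have small : (((r - 1) / r * u) ^+ 2 * T)%:E <= (2 * M)%:E * kappa K r x0 ^+ 2.
  apply: le_trans (weighted_cauchy_schwarz D w g T (2 * M) ((r - 1) / r * u) mD mw _ mg
  _ T0 _ c0 _ g_large (le_lt_trans kappa_ge kappa_fin)) _.
  - by move=> a _; exact: sqrtr_ge0.
  - by move=> z; exact: measure_ge0.
  - by rewrite mulr_ge0.
  - move=> a Da; rewrite sqr_sqrtr ?aK0// [leRHS]EFinM /M (fineK Mfin).
    apply: (window_square_bound _ _ _ K_ge0 r_gt1 f_sol M1_fin); first exact: D0.
    exact: ltW.
  - apply: lee_wpmul2l; first by rewrite lee_fin mulr_ge0.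
    apply: le_sqre kappa_ge.
    by apply: integral_ge0 => a _; rewrite inve_ge0 lee_fin sqrtr_ge0.
move: small; rewrite -(fineK kfin) -/k -EFin_expe -EFinM lee_fin.
apply/negP; rewrite -ltNge.
move: BT1; rewrite BE lte_fin.
have r1 : (0 < r - 1)%R by rewrite subr_gt0.
have q0 : (0 < ((r - 1) / r * u) ^+ 2)%R by rewrite exprn_gt0.
rewrite -(ltr_pM2l q0); apply: le_lt_trans.
rewrite le_eqVlt; apply/orP; left; apply/eqP.
by field; rewrite !gt_eqF.
Qed.
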